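(* Let $P$ be a poset with no infinite antichain and $\alpha$ a countable ordinal. Then $AM_2(P)$ is $\alpha$-bqo if and only if $\bigcup AM_2(P)$ is $\alpha$-bqo.
   Context: $AM_2(P)$ is the set of maximal antichains of $P$ having exactly two elements, ordered by domination: $X\leq Y$ iff for every $x\in X$ there is $y\in Y$ with $x\leq y$. $\bigcup AM_2(P)$ is the union of all these antichains, with the order induced from $P$. Barriers and $\alpha$-bqo: finite subsets of $\mathbb{N}$ are identified with their increasing enumerations. For finite $s,t\subseteq\mathbb{N}$ write $s\triangleleft t$ if there is a finite $r\subseteq\mathbb{N}$ such that $s$ is a proper initial segment of $r$ and $t$ is $r$ with its least element removed. A barrier is an infinite set $B$ of finite subsets of $\mathbb{N}$, no member of which is a proper subset of another, such that every infinite $X\subseteq\bigcup B$ has a nonempty initial segment belonging to $B$. A barrier is well-ordered by the lexicographic order; its order type is the type of this well-order. A map $f$ from a barrier $B$ into a quasi-ordered set $Q$ is good if there exist $s,t\in B$ with $s\triangleleft t$ and $f(s)\leq f(t)$, and bad otherwise. $Q$ is $\alpha$-bqo if every map from a barrier of order type at most $\alpha$ into $Q$ is good. *)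

(* Defs.v *)
From Stdlib Require List.
From mathcomp Require Import all_boot.
Set Implicit Arguments. Unset Strict Implicit. Unset Printing Implicit Defensive.

Definition finite_set (T : Type) (A : T -> Prop) : Prop :=
  exists l : list T, forall x, A x -> List.In x l.

Definition is_poset (P : Type) (le : P -> P -> Prop) : Prop :=
  (forall x, le x x) /\ (forall x y z, le x y -> le y z -> le x z) /\
  (forall x y, le x y -> le y x -> x = y).

Definition antichain (P : Type) (le : P -> P -> Prop) (A : P -> Prop) : Prop :=
  forall x y, A x -> A y -> le x y -> x = y.

Definition no_infinite_antichain (P : Type) (le : P -> P -> Prop) : Prop :=
  forall A : P -> Prop, antichain le A -> finite_set A.

Definition maximal_antichain (P : Type) (le : P -> P -> Prop) (A : P -> Prop) : Prop :=
  antichain le A /\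
  forall z, ~ A z -> exists x, A x /\ (le x z \/ le z x).

Definition two_elements (P : Type) (A : P -> Prop) : Prop :=
  exists a b, a <> b /\ forall x, A x <-> (x = a \/ x = b).

Definition in_AM2 (P : Type) (le : P -> P -> Prop) (A : P -> Prop) : Prop :=
  maximal_antichain le A /\ two_elements A.

Definition AM2 (P : Type) (le : P -> P -> Prop) := {A : P -> Prop | in_AM2 le A}.

Definition AM2_le (P : Type) (le : P -> P -> Prop) (X Y : AM2 le) : Prop :=
  forall x, proj1_sig X x -> exists y, proj1_sig Y y /\ le x y.

Definition UAM2 (P : Type) (le : P -> P -> Prop) :=
  {x : P | exists A, in_AM2 le A /\ A x}.

Definition UAM2_le (P : Type) (le : P -> P -> Prop) (x y : UAM2 le) : Prop :=
  le (proj1_sig x) (proj1_sig y).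

Definition fin_nat (s : seq nat) : Prop := sorted ltn s.

Definition proper_subset (s t : seq nat) : Prop :=
  {subset s <= t} /\ exists n, n \in t /\ n \notin s.

Definition nonempty_initial_segment (s : seq nat) (X : nat -> Prop) : Prop :=
  fin_nat s /\ s <> [::] /\ (forall n, n \in s -> X n) /\
  (forall n, X n -> n <= last 0 s -> n \in s).

Definition barrier (B : seq nat -> Prop) : Prop :=
  (forall s, B s -> fin_nat s) /\
  ~ finite_set B /\
  (forall s t, B s -> B t -> ~ proper_subset s t) /\
  (forall X : nat -> Prop, ~ finite_set X ->
     (forall n, X n -> exists s, B s /\ n \in s) ->
     exists s, B s /\ nonempty_initial_segment s X).

Definition tri (s t : seq nat) : Prop :=
  exists r, fin_nat r /\ (exists u, u <> [::] /\ r = s ++ u) /\ t = behead r.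

Definition lexlt (s t : seq nat) : Prop :=
  (exists u, u <> [::] /\ t = s ++ u) \/
  (exists p a b s' t', s = p ++ a :: s' /\ t = p ++ b :: t' /\ a < b).

(* ---------- countable ordinals, presented as countable well-orders ---------- *)
Definition countable_well_order (W : Type) (ltW : W -> W -> Prop) : Prop :=
  (forall x, ~ ltW x x) /\
  (forall x y z, ltW x y -> ltW y z -> ltW x z) /\
  (forall x y, ltW x y \/ x = y \/ ltW y x) /\
  well_founded ltW /\
  (exists c : W -> nat, forall x y, c x = c y -> x = y).

Definition otype_le (B : seq nat -> Prop) (W : Type) (ltW : W -> W -> Prop) : Prop :=
  exists g : seq nat -> W, forall s t, B s -> B t -> lexlt s t -> ltW (g s) (g t).

Definition good (Q : Type) (leQ : Q -> Q -> Prop) (B : seq nat -> Prop)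
  (f : seq nat -> Q) : Prop :=
  exists s t, B s /\ B t /\ tri s t /\ leQ (f s) (f t).

Definition alpha_bqo (W : Type) (ltW : W -> W -> Prop)
  (Q : Type) (leQ : Q -> Q -> Prop) : Prop :=
  forall B : seq nat -> Prop, barrier B -> otype_le B ltW ->
  forall f : seq nat -> Q, good leQ B f.

(* Main.v *)
(** Infinite subsets of [nat] are increasing functions, and a clopen Ramsey
    theorem for them homogenises finitely many comparisons at a time. If a map
    into [AM_2] is bad, then after homogenising one fixed element of the pair
    already witnesses this, and it gives a bad map into the union. Conversely,
    given a bad map [F] into the union, extend each [F s] to a maximal antichain
    [{F s, G s}]. On some subbarrier all these pairs satisfy
    [{F s, G s} <= {F t, G t}] for [s <| t]; since [F s <= F t] fails, the
    domination is crossed, [F s <= G t] and [G s <= F t]. Maximality makes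
    [F s] comparable with [F u] or [G u] for [u] interleaved between [s] and
    [t], and homogeneity rules out every case. *)

Require Import Defs.
From mathcomp Require Import all_boot.
From Stdlib Require Import Classical ClassicalEpsilon FunctionalExtensionality.
Set Implicit Arguments. Unset Strict Implicit. Unset Printing Implicit Defensive.

(** * Infinite sets of naturals as increasing functions *)

Definition incr (Z : nat -> nat) : Prop := forall i, Z i < Z i.+1.

Definition subrange (Z Y : nat -> nat) : Prop := forall i, exists j, Z i = Y j.

Definition shift (Z : nat -> nat) : nat -> nat := fun i => Z i.+1.

Definition prepend (s : seq nat) (Z : nat -> nat) : nat -> nat :=
  fun i => if i < size s then nth 0 s i else Z (i - size s).

Lemma incr_leq Z : incr Z -> {mono Z : i j / i <= j}.
Proof. by move=> hZ; apply: leq_mono; exact: (homo_ltn ltn_trans hZ). Qed.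

Lemma incr_ltn Z : incr Z -> {mono Z : i j / i < j}.
Proof. by move=> hZ; apply: leqW_mono; exact: incr_leq. Qed.

Lemma incr_ge Z i : incr Z -> i <= Z i.
Proof. by move=> hZ; elim: i => // i; move/leq_ltn_trans; apply; exact: hZ. Qed.

Lemma incr_comp Z h : incr Z -> incr h -> incr (Z \o h).
Proof. by move=> hZ hh i /=; rewrite incr_ltn. Qed.

Lemma incr_shift Z : incr Z -> incr (shift Z).
Proof. by move=> hZ i; exact: hZ. Qed.

Lemma subrange_trans Y X Z : subrange X Y -> subrange Y Z -> subrange X Z.
Proof. by move=> h1 h2 i; have [j ->] := h1 i; exact: h2. Qed.

Lemma subrange_comp Z h : subrange (Z \o h) Z.
Proof. by move=> i; exists (h i). Qed.

Lemma subrange_shift Z : subrange (shift Z) Z.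
Proof. by move=> i; exists i.+1. Qed.

Lemma subrange_gt Z Y a :
  subrange Z Y -> (forall i, a < Y i) -> forall i, a < Z i.
Proof. by move=> hs ha i; have [j ->] := hs i. Qed.

Lemma incr_enum (A : nat -> Prop) :
  (forall n, exists m, n < m /\ A m) -> exists2 h, incr h & forall i, A (h i).
Proof.
move=> hA.
pose nx n := proj1_sig (constructive_indefinite_description _ (hA n)).
have nxP n : n < nx n /\ A (nx n).
  exact: (proj2_sig (constructive_indefinite_description _ (hA n))).
exists (fun i => iter i.+1 nx 0) => i /=; last by case: (nxP (iter i nx 0)).
by case: (nxP (nx (iter i nx 0))).
Qed.

Lemma dichotomy_enum (A A' : nat -> Prop) : (forall n, A n \/ A' n) ->
  exists2 h, incr h & (forall i, A (h i)) \/ (forall i, A' (h i)).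
Proof.
move=> hAA.
case: (classic (forall n, exists m, n < m /\ A m)) => [/incr_enum [h hh hA]|].
  by exists h => //; left.
move=> /not_all_ex_not [n hn].
have /incr_enum [h hh hA] : forall k, exists m, k < m /\ A' m.
  move=> k; exists (maxn n k).+1; split; first by rewrite ltnS leq_maxr.
  case: (hAA (maxn n k).+1) => // hA; case: hn.
  by exists (maxn n k).+1; rewrite ltnS leq_maxl.
by exists h => //; right.
Qed.

(** * A clopen Ramsey theorem for increasing functions *)

Section Ramsey.

Variable C : (nat -> nat) -> Prop.

Definition monochromatic (s : seq nat) (Y : nat -> nat) : Prop :=
  (forall Z, incr Z -> subrange Z Y -> C (prepend s Z)) \/
  (forall Z, incr Z -> subrange Z Y -> ~ C (prepend s Z)).

(** The Ramsey property localised at a stem [s]; the stem [[::]] gives the theorem itself. *)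
Definition ramsey_above (s : seq nat) : Prop :=
  forall X, incr X -> exists Y, [/\ incr Y, subrange Y X & monochromatic s Y].

Lemma prepend_rcons s Z :
  prepend (rcons s (Z 0)) (shift Z) = prepend s Z.
Proof.
apply: functional_extensionality => i; rewrite /prepend /shift size_rcons ltnS nth_rcons.
case: ltngtP => // [hi|->]; last by rewrite subnn.
by rewrite subnSK.
Qed.

(* Diagonalise: [U k.+1] is monochromatic above [rcons s (U k 0)] and lies
   inside [shift (U k)]; then the colour of a set of points [U k 0] depends
   on its least element only. *)
Lemma ramsey_above_step s :
  (forall x, last 0 s < x -> ramsey_above (rcons s x)) -> ramsey_above s.
Proof.
move=> hs X hX.
(* The conditions on [x] and [V] sit under the existential, with [V] as default witness, so that
   choice yields a total [phi]. *)
have step x V : exists Y, last 0 s < x -> incr V ->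
    [/\ incr Y, subrange Y V & monochromatic (rcons s x) Y].
  case: (classic (last 0 s < x /\ incr V)) => [[hx hV]|hn].
    by have [Y hY] := hs x hx V hV; exists Y.
  by exists V => hx hV; case: hn.
pose phi x V := proj1_sig (constructive_indefinite_description _ (step x V)).
have phiP x V : last 0 s < x -> incr V ->
    [/\ incr (phi x V), subrange (phi x V) V & monochromatic (rcons s x) (phi x V)].
  exact: (proj2_sig (constructive_indefinite_description _ (step x V))).
(* Dropping the first [(last 0 s).+1] values leaves only points above [s], where [hs] applies. *)
pose U0 i := X (i + (last 0 s).+1).
pose U k := iter k (fun V => phi (V 0) (shift V)) U0.
have US k : U k.+1 = phi (U k 0) (shift (U k)) by [].
have U0gt i : last 0 s < U0 i.
  by apply: leq_trans (incr_ge _ hX); rewrite leq_addl.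
have Uinv k : incr (U k) /\ subrange (U k) U0.
  elim: k => [|k [ih1 ih2]].
    by split=> i; [exact: hX | exists i].
  have [h1 h2 _] := phiP _ _ (subrange_gt ih2 U0gt 0) (incr_shift ih1).
  rewrite US; split=> //; apply: subrange_trans h2 _.
  exact: subrange_trans (@subrange_shift _) ih2.
have Ustep k : subrange (U k.+1) (shift (U k)) /\
    monochromatic (rcons s (U k 0)) (U k.+1).
  have [h1 h2] := Uinv k.
  by have [_ ? ?] := phiP _ _ (subrange_gt h2 U0gt 0) (incr_shift h1).
have Usub k d : subrange (U (d + k)) (U k).
  elim: d => [|d ih]; first by move=> i; exists i.
  apply: subrange_trans ih; rewrite addSn.
  apply: subrange_trans (@subrange_shift _).
  by have [] := Ustep (d + k).
pose x k := U k 0.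
have xincr : incr x.
  move=> k; have [hU _] := Ustep k; have [j] := hU 0.
  by rewrite /x => ->; have [hU' _] := Uinv k; rewrite /shift incr_ltn.
(* Taking [c] to be the identity or negation treats both colours at once. *)
pose mono (c : Prop -> Prop) k := forall Z, incr Z -> subrange Z (U k.+1) ->
  c (C (prepend (rcons s (x k)) Z)).
have [h hh hcol] : exists2 h, incr h &
    (forall i, mono id (h i)) \/ (forall i, mono not (h i)).
  apply: dichotomy_enum => k.
  by have [_ [?|?]] := Ustep k; [left | right].
exists (x \o h); split.
- exact: incr_comp.
- move=> i; have [_ hU] := Uinv (h i); have [j hj] := hU 0.
  by exists (j + (last 0 s).+1).
have tail c Z : (forall i, mono c (h i)) -> incr Z -> subrange Z (x \o h) ->
    c (C (prepend s Z)).
  move=> hc hZ hsub; have [i hi] := hsub 0.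
  rewrite -prepend_rcons hi; apply: hc; first exact: incr_shift.
  move=> j; have [j' hj'] := hsub j.+1; rewrite /shift hj' /=.
  have hlt : h i < h j'.
    by rewrite -(incr_ltn xincr) -[x (h i)]hi -[x (h j')]hj' incr_ltn.
  by have := @Usub (h i).+1 (h j' - (h i).+1) 0; rewrite subnK.
by case: hcol => hc; [left | right] => Z; [exact: (tail id) | exact: (tail not)].
Qed.

(** Clopenness of [C]: a finite part of each [Z] decides membership. *)
Hypothesis C_continuous : forall Z, incr Z -> exists n, forall Z', incr Z' ->
  (forall i, i < n -> Z' i = Z i) -> (C Z' <-> C Z).

(** If the empty stem failed, [ramsey_above_step] would extend it point by point through failing
    stems. Their union is an increasing [Z]; by continuity some finite stem of it already decides
    [C], so that stem cannot fail. *)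
Lemma ramsey_above_nil : ramsey_above [::].
Proof.
apply: NNPP => hnil.
have step s : exists x, ~ ramsey_above s ->
    last 0 s < x /\ ~ ramsey_above (rcons s x).
  case: (classic (ramsey_above s)) => [hs|hs]; first by exists 0.
  apply: NNPP => hn; apply: hs; apply: ramsey_above_step => x hx.
  by apply: NNPP => hx'; apply: hn; exists x.
pose nx s := proj1_sig (constructive_indefinite_description _ (step s)).
have nxP s : ~ ramsey_above s -> last 0 s < nx s /\ ~ ramsey_above (rcons s (nx s)).
  exact: (proj2_sig (constructive_indefinite_description _ (step s))).
pose S k := iter k (fun s => rcons s (nx s)) [::].
have Sbad k : ~ ramsey_above (S k) by elim: k => // k /nxP [].
pose Z k := nx (S k).
have SE k : S k = mkseq Z k by elim: k => // k ih; rewrite mkseqS -ih.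
have Zincr : incr Z.
  move=> k; rewrite {2}/Z; have [+ _] := nxP _ (Sbad k.+1).
  by rewrite {1}/S iterS last_rcons.
have [n hn] := C_continuous Zincr.
apply: (Sbad n) => X hX.
(* Starting above the stem makes [prepend (S n) Z'] increasing, as continuity requires. *)
pose Y i := X (i + (last 0 (S n)).+1).
have Ygt i : last 0 (S n) < Y i.
  by apply: leq_trans (incr_ge _ hX); rewrite leq_addl.
exists Y; split; first by move=> i; exact: hX.
  by move=> i; eexists.
have pre_iff Z' : incr Z' -> subrange Z' Y -> (C (prepend (S n) Z') <-> C Z).
  move=> hZ' hsub; apply: hn => i; last first.
    by move=> hi; rewrite /prepend SE size_mkseq hi nth_mkseq.
  rewrite /prepend SE size_mkseq; case: (ltngtP i.+1 n) => hi.
  - by rewrite !nth_mkseq // ltnW.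
  - by rewrite subSn.
  - rewrite -hi subnn nth_mkseq //.
    have := subrange_gt hsub Ygt 0.
    by rewrite SE -hi mkseqS last_rcons.
case: (classic (C Z)) => hC; [left | right] => Z' h1 h2.
  by apply/(pre_iff Z').
by move/(pre_iff Z' h1 h2).
Qed.

Theorem clopen_ramsey X : incr X -> exists Y, [/\ incr Y, subrange Y X &
  (forall Z, incr Z -> subrange Z Y -> C Z) \/
  (forall Z, incr Z -> subrange Z Y -> ~ C Z)].
Proof.
move=> hX; have [Y [h1 h2 h3]] := ramsey_above_nil hX; exists Y; split=> //.
have pre0 Z : prepend [::] Z = Z.
  by apply: functional_extensionality => i; rewrite /prepend /= subn0.
by case: h3 => h; [left | right] => Z hZ hs; rewrite -(pre0 Z); apply: h.
Qed.

End Ramsey.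

(** * Finite sets and sorted sequences *)

Lemma finite_set_bounded T (A : T -> Prop) (m : T -> nat) :
  finite_set A -> exists N, forall x, A x -> m x <= N.
Proof.
move=> [l hl].
suff [N hN] : exists N, forall x, List.In x l -> m x <= N.
  by exists N => x /hl /hN.
elim: l {hl} => [|y l [N ih]]; first by exists 0.
exists (maxn (m y) N) => x /= [<-|/ih h]; rewrite leq_max ?leqnn //.
by rewrite h orbT.
Qed.

Lemma range_infinite Z : incr Z -> ~ finite_set (fun n => exists i, n = Z i).
Proof.
move=> hZ /(finite_set_bounded id) [N hN].
have : Z N.+1 <= N by apply: hN; exists N.+1.
by rewrite leqNgt (incr_ge N.+1 hZ).
Qed.

(** Each such sequence is [iota 0 N] cut down by one of the finitely many Boolean masks of length
    [N]. *)
Lemma finite_sorted_below N :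
  finite_set (fun s => sorted ltn s /\ forall n, n \in s -> n < N).
Proof.
exists [seq mask (val m) (iota 0 N) | m <- enum {: N.-tuple bool}] => s [hs hN].
have InP (T : eqType) (x : T) l : x \in l -> List.In x l.
  by elim: l => //= y l ih; rewrite in_cons => /orP [/eqP ->|/ih]; [left | right].
apply: InP.
have Es : s = [seq n <- iota 0 N | n \in s].
  apply: (irr_sorted_eq ltn_trans ltnn) => //.
    by apply: sorted_filter (iota_ltn_sorted 0 N); exact: ltn_trans.
  by move=> n; rewrite mem_filter mem_iota; case: (boolP (n \in s)) => // /hN.
have /subseqP [m hm ->] : subseq s (iota 0 N) by rewrite Es filter_subseq.
rewrite size_iota in hm.
have hm' : size m == N by apply/eqP.
by apply/mapP; exists (Tuple hm'); rewrite ?mem_enum.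
Qed.

Lemma leq_last_sorted s n : sorted ltn s -> n \in s -> n <= last 0 s.
Proof.
move=> hs hn.
have hs' : sorted leq s by apply: sub_sorted hs => ? ? /ltnW.
have hsz : 0 < size s by case: s hn {hs hs'}.
rewrite -nth_last -(nth_index 0 hn).
apply: (sorted_leq_nth leq_trans leqnn 0 hs'); rewrite ?inE ?index_mem ?prednK //.
by rewrite -ltnS prednK // index_mem.
Qed.

Lemma sorted_mkseq X k : incr X -> sorted ltn (mkseq X k).
Proof.
move=> hX; rewrite sorted_map; apply: sub_sorted (iota_ltn_sorted 0 k).
by move=> a b; rewrite /= incr_ltn.
Qed.

Lemma mkseq_eq X s j : incr X -> sorted ltn s -> last 0 s = X j ->
  (forall n, n \in s -> exists i, n = X i) ->
  (forall i, i <= j -> X i \in s) -> s = mkseq X j.+1.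
Proof.
move=> hX hs hl h1 h2.
apply: (irr_sorted_eq ltn_trans ltnn hs (sorted_mkseq _ hX)) => n.
apply/idP/mapP => [hn|[i]]; last first.
  by rewrite mem_iota /= add0n ltnS => hi ->; exact: h2.
have [i hi] := h1 n hn; exists i => //; rewrite mem_iota /= add0n ltnS.
by rewrite -(incr_leq hX) -hi -hl leq_last_sorted.
Qed.

(** * Members of a barrier as segments of increasing functions *)

Section Barrier.

Variable B : seq nat -> Prop.
Hypothesis hB : barrier B.

Lemma barrier_nil : ~ B [::].
Proof.
move=> hn; have [_ [hinf [hanti _]]] := hB; apply: hinf.
exists [:: [::]] => -[|a s] hs; first by left.
by case: (hanti _ _ hn hs); split=> //; exists a; rewrite mem_head.
Qed.

(** Otherwise the union of [B] would be bounded, leaving only finitely many sorted sequences. The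
    function [e] need not exhaust this union. *)
Lemma barrier_enum :
  exists2 e, incr e & forall i, exists s, B s /\ e i \in s.
Proof.
have [hfin [hinf _]] := hB.
apply: (@incr_enum (fun n => exists s, B s /\ n \in s)) => n.
apply: NNPP => hn; apply: hinf.
have [l hl] := finite_sorted_below n.+1; exists l => s hs; apply: hl.
split; first exact: hfin.
move=> m hm; rewrite ltnS leqNgt; apply/negP => hlt.
by apply: hn; exists m; split=> //; exists s.
Qed.

Variable e : nat -> nat.
Hypothesis e_incr : incr e.
Hypothesis e_supp : forall i, exists s, B s /\ e i \in s.

Lemma seg_ex Z : incr Z -> exists k, B (mkseq (e \o Z) k).
Proof.
move=> hZ; have [_ [_ [_ hX]]] := hB; have heZ := incr_comp e_incr hZ.
have [] := hX _ (range_infinite heZ).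
  by move=> n [i ->]; exact: e_supp.
move=> s [hs [hfin [hs0 [h1 h2]]]].
have [j hj] : exists j, last 0 s = (e \o Z) j.
  by apply: h1; case: s hs0 {hs hfin h2} => //= a s _; rewrite mem_last.
exists j.+1; rewrite -(@mkseq_eq (e \o Z) s j) // => i hi.
by apply: h2; [exists i | rewrite hj incr_leq].
Qed.

(** Meaningful for increasing [Z]: such a length then exists by [seg_ex] and is unique by
    [barrier_mkseq_le]. *)
Definition seglen (Z : nat -> nat) : nat :=
  epsilon (inhabits 0) (fun k => B (mkseq (e \o Z) k)).

Definition seg (Z : nat -> nat) : seq nat := mkseq (e \o Z) (seglen Z).

Lemma seg_in Z : incr Z -> B (seg Z).
Proof. by move=> /seg_ex h; exact: (epsilon_spec (inhabits 0) _ h). Qed.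

(** Both sequences are windows of [X], the first inside the second. If they differed, [X c] or
    [X (a + k)] would lie only in the larger one, against the inclusion condition on barriers. *)
Lemma barrier_mkseq_le (X : nat -> nat) a k c m : incr X ->
  B (mkseq (fun i => X (i + a)) k) -> B (mkseq (fun i => X (i + c)) m) ->
  c <= a -> a + k <= c + m -> a = c /\ k = m.
Proof.
move=> hX hk hm hca hkm; have [_ [_ [hanti _]]] := hB.
apply: NNPP => hne; apply: (hanti _ _ hk hm); split.
  move=> n /mapP [i]; rewrite mem_iota add0n => /= hi ->.
  apply/mapP; exists (i + a - c); last by rewrite subnK // (leq_trans hca) // leq_addl.
  rewrite mem_iota add0n /= -(ltn_add2r c) subnK ?(leq_trans hca) ?leq_addl //.
  by rewrite addnC [m + c]addnC (leq_trans _ hkm) // ltn_add2l.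
have X_in i a' k' : (X i \in mkseq (fun i => X (i + a')) k') -> a' <= i < a' + k'.
  move/mapP => [j]; rewrite mem_iota add0n /= => hj hij.
  have -> : i = j + a' by apply: (incn_inj (incr_leq hX)).
  by rewrite leq_addl addnC ltn_add2l.
have X_mem i : c <= i < c + m -> X i \in mkseq (fun i => X (i + c)) m.
  move=> /andP [h1 h2]; apply/mapP; exists (i - c); last by rewrite subnK.
  by rewrite mem_iota add0n /= ltn_subLR.
case: (ltngtP c a) hca => // [hca _|hca _].
  exists (X c); split; last by apply/negP => /X_in; rewrite leqNgt hca.
  by apply: X_mem; rewrite leqnn (leq_trans _ hkm) // (leq_trans hca) // leq_addr.
subst c; rewrite leq_add2l in hkm.
have {hkm} hkm : k < m.
  by rewrite ltn_neqAle hkm andbT; apply/eqP => hkm'; apply: hne.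
exists (X (a + k)); split; last by apply/negP => /X_in; rewrite ltnn andbF.
by apply: X_mem; rewrite leq_addr ltn_add2l.
Qed.

Lemma seg_unique Z k : incr Z -> B (mkseq (e \o Z) k) -> seg Z = mkseq (e \o Z) k.
Proof.
move=> hZ hk; have hs := seg_in hZ; rewrite /seg.
suff -> : seglen Z = k by [].
have h0 : (fun i => (e \o Z) (i + 0)) = e \o Z.
  by apply: functional_extensionality => i; rewrite addn0.
have heZ := incr_comp e_incr hZ; rewrite /seg -h0 in hs hk.
case: (leqP (seglen Z) k) => [hle|/ltnW hle].
  by have [] := barrier_mkseq_le heZ hs hk.
by have [] := barrier_mkseq_le heZ hk hs.
Qed.

(** The old segment is also a prefix of [e \o Z'] in [B], so uniqueness applies. This supplies
    continuity for the Ramsey theorem. *)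
Lemma seg_local Z Z' : incr Z -> incr Z' ->
  (forall i, i < seglen Z -> Z' i = Z i) -> seg Z' = seg Z.
Proof.
move=> hZ hZ' hE.
have E : seg Z = mkseq (e \o Z') (seglen Z).
  apply/eq_in_map => i; rewrite mem_iota add0n => /= hi.
  by rewrite hE.
by rewrite E; apply: seg_unique => //; rewrite -E; exact: seg_in.
Qed.

Lemma seg_tri Z : incr Z -> tri (seg Z) (seg (shift Z)).
Proof.
move=> hZ; set k := seglen Z; set m := seglen (shift Z).
have heZ := incr_comp e_incr hZ.
(* Otherwise the window of [shift Z] would sit properly inside that of [Z]. *)
have hkm : k <= m.
  rewrite leqNgt; apply/negP => hmk.
  have h0 : mkseq (fun i => (e \o Z) (i + 0)) k = seg Z.
    by apply: eq_map => i; rewrite addn0.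
  have h1 : mkseq (fun i => (e \o Z) (i + 1)) m = seg (shift Z).
    by apply: eq_map => i; rewrite addn1.
  have [] // := @barrier_mkseq_le (e \o Z) 1 m 0 k heZ.
  - by rewrite h1; apply: seg_in; exact: incr_shift.
  - by rewrite h0; exact: seg_in.
exists (mkseq (e \o Z) m.+1); split; [|split].
- rewrite /fin_nat sorted_map; apply: sub_sorted (iota_ltn_sorted 0 m.+1).
  by move=> a b; rewrite /= !incr_ltn.
- exists [seq (e \o Z) i | i <- iota k (m.+1 - k)]; split.
    by rewrite subSn.
  by rewrite -map_cat -iotaD subnKC // ltnW.
- rewrite /seg /mkseq /= -[1]/(1 + 0) iotaDl -map_comp.
  by apply: eq_map.
Qed.

(** The colouring is clopen by [seg_local]. Reindexing by [id] and [succn] compares consecutive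
    segments; [double] and its successor compare interleaved ones. *)
Lemma seg_ramsey (R : seq nat -> seq nat -> Prop) p q X :
  incr p -> incr q -> incr X ->
  exists Y, [/\ incr Y, subrange Y X &
  (forall Z, incr Z -> subrange Z Y -> R (seg (Z \o p)) (seg (Z \o q))) \/
  (forall Z, incr Z -> subrange Z Y -> ~ R (seg (Z \o p)) (seg (Z \o q)))].
Proof.
move=> hp hq; apply: (@clopen_ramsey (fun Z => R (seg (Z \o p)) (seg (Z \o q)))).
move=> Z hZ; exists (maxn (p (seglen (Z \o p))) (q (seglen (Z \o q)))).
move=> Z' hZ' hE.
rewrite (@seg_local (Z \o p) (Z' \o p)); try exact: incr_comp; last first.
  by move=> i hi; apply: hE; rewrite leq_max incr_ltn ?hi.
rewrite (@seg_local (Z \o q) (Z' \o q)); try exact: incr_comp; last first.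
  by move=> i hi; apply: hE; rewrite leq_max [X in _ || X]incr_ltn ?hi ?orbT.
by [].
Qed.

Definition restrict (H : nat -> nat) (s : seq nat) : Prop :=
  B s /\ forall n, n \in s -> exists i, n = e (H i).

(** Segments of tails of [H] have unbounded last entries, hence infinitude. The member of [B] found
    for [X] consists of points of [X], so it lies in the range of [e \o H]. *)
Lemma restrict_barrier H : incr H -> barrier (restrict H).
Proof.
move=> hH; have [h1 [h2 [h3 h4]]] := hB; split; [|split; [|split]].
- by move=> s [/h1].
- move=> /(finite_set_bounded (last 0)) [N hN].
  pose Z i := H (i + N.+1).
  have hZ : incr Z by move=> i; exact: hH.
  have hBZ := seg_in hZ.
  have : last 0 (seg Z) <= N.
    apply: hN; split=> // n /mapP [i _ ->].
    by exists (i + N.+1).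
  rewrite /seg; case E : (seglen Z) => [|k].
    by case: barrier_nil; rewrite /seg E in hBZ.
  rewrite mkseqS last_rcons /= leqNgt => /negP; apply.
  apply: leq_trans (incr_ge _ e_incr); apply: leq_trans (incr_ge _ hH).
  by rewrite leq_addl.
- by move=> s t [hs _] [ht _]; exact: h3.
- move=> X hX hsup; have [n /hsup [s [[hs _] hn]]|s [hs hini]] := h4 X hX.
    by exists s.
  exists s; split=> //; split=> // n hn.
  by have [_ [_ [/(_ n hn) /hsup [t [[_ ht] hnt]] _]]] := hini; exact: ht.
Qed.

(** A converse to [seg_tri]: the common extension [r] is pulled back to indices along [H] and
    prolonged to an infinite [Z]. *)
Lemma seg_realize H s t : incr H -> restrict H s -> restrict H t -> tri s t ->
  exists Z, [/\ incr Z, subrange Z H, s = seg Z & t = seg (shift Z)].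
Proof.
move=> hH [hs hsH] [ht htH] [r [hr [[u [hu hru]] htr]]].
have hs0 : 0 < size s by case: s hs {hsH hru} => // /barrier_nil.
pose m := size r.
have hsm : size s < m.
  by rewrite /m hru size_cat; case: u hu {hru} => // a u _; rewrite addnS ltnS leq_addr.
have m0 : 0 < m by apply: leq_trans hsm.
have hj i : exists j, i < m -> nth 0 r i = e (H j).
  case: (ltnP i m) => hi; last by exists 0.
  suff [j ->] : exists j, nth 0 r i = e (H j) by exists j.
  case: i hi => [_|i hi].
    by apply: hsH; rewrite hru nth_cat hs0 mem_nth.
  by apply: htH; rewrite htr -nth_behead mem_nth // size_behead -ltnS prednK.
pose j i := proj1_sig (constructive_indefinite_description _ (hj i)).
have jP i : i < m -> nth 0 r i = e (H (j i)).
  exact: (proj2_sig (constructive_indefinite_description _ (hj i))).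
(* Past [r], [Z] continues with the values of [H] right after position [j m.-1]; the offset
   [i - m.-1] is 1 at [i = m]. *)
pose Z i := if i < m then H (j i) else H (j m.-1 + (i - m.-1)).
have hZ : incr Z.
  move=> i; rewrite /Z; case: (ltngtP i.+1 m) => hi.
  - rewrite -(incr_ltn e_incr) -!jP ?(ltnW hi) //.
    by have /(_ i i.+1 (ltnW hi) hi (ltnSn i)) := sorted_ltn_nth ltn_trans 0 hr.
  - rewrite incr_ltn // ltn_add2l subSn //.
    by rewrite -ltnS prednK // ltnW.
  - by rewrite -hi /= incr_ltn // subSn // subnn addn1.
have rE k : k <= m -> mkseq (e \o Z) k = take k r.
  move=> hk; apply: (@eq_from_nth _ 0); rewrite size_mkseq ?size_takel //.
  move=> i hi; rewrite nth_mkseq // nth_take // /= /Z (leq_trans hi hk) jP //.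
  exact: leq_trans hi hk.
have sE : s = mkseq (e \o Z) (size s) by rewrite rE 1?ltnW // hru take_size_cat.
have tE : t = mkseq (e \o shift Z) m.-1.
  rewrite htr -[in LHS](take_size r) -/m -rE // -{1}(prednK m0) /mkseq /=.
  by rewrite -[1]/(1 + 0) iotaDl -map_comp.
exists Z; split=> //.
- by move=> i; rewrite /Z; case: ifP => _; eexists.
- by rewrite [LHS]sE -seg_unique // -sE.
- by rewrite [LHS]tE -seg_unique -?tE //; exact: incr_shift.
Qed.

(** The map [g] also bounds the order type of [restrict H], so goodness holds inside every [H]. This
    rules out the negative colour after [seg_ramsey]. *)
Lemma alpha_bqo_seg W (ltW : W -> W -> Prop) Q (leQ : Q -> Q -> Prop)
    (f : seq nat -> Q) H :
  alpha_bqo ltW leQ -> otype_le B ltW -> incr H ->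
  exists Z, [/\ incr Z, subrange Z H & leQ (f (seg Z)) (f (seg (shift Z)))].
Proof.
move=> hQ [g hg] hH.
have hg' : otype_le (restrict H) ltW by exists g => s t [? _] [? _]; exact: hg.
have [s [t [hs [ht [hst hle]]]]] := hQ _ (restrict_barrier hH) hg' f.
have [Z [hZ hZH Es Et]] := seg_realize hH hs ht hst.
by exists Z; rewrite -Es -Et.
Qed.

End Barrier.

(** * Maximal two-element antichains *)

Section Pairs.

Variables (P : Type) (le : P -> P -> Prop).
Hypothesis le_poset : is_poset le.

Definition maximal_pair (a b : P) : Prop :=
  [/\ ~ le a b, ~ le b a &
   forall z, (le a z \/ le z a) \/ (le b z \/ le z b)].

Lemma in_AM2_maximal_pair A a : in_AM2 le A -> A a ->
  exists b, maximal_pair a b /\ forall x, A x <-> x = a \/ x = b.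
Proof.
have [refl _] := le_poset.
move=> [[anti hmax] [c [d [hcd hA]]]] ha.
have [b [hab {hA}hA]] : exists b, a <> b /\ forall x, A x <-> x = a \/ x = b.
  case/hA: ha => ->; [exists d | exists c]; split=> //; first exact: nesym.
  by move=> x; rewrite hA; tauto.
have hb : A b by apply/hA; right.
exists b; split=> //; split.
- by move/(anti _ _ ha hb).
- by move/(anti _ _ hb ha)/esym.
- move=> z; case: (classic (A z)) => [/hA [->|->]|/hmax [x [/hA [->|->] hz]]].
  + by left; left; exact: refl.
  + by right; left; exact: refl.
  + by left.
  + by right.
Qed.

(** If [a] and [a'] were both below [b'], then [b], comparable with one of them, could not be below
    it without being below [b']; so [b] is above [a']. *)
Lemma domination_crossing a a' b b' :
  maximal_pair a a' -> maximal_pair b b' ->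
  le a b \/ le a b' -> le a' b \/ le a' b' -> ~ le a b ->
  le a b' /\ le a' b.
Proof.
have [_ [trans _]] := le_poset.
move=> [_ _ ha] [hbb' _ _] hab ha'b nab.
have {hab} hab : le a b' by case: hab.
split=> //; case: ha'b => // ha'b'.
case: (ha b) => -[] // h; case: hbb'; [exact: trans hab | exact: trans ha'b'].
Qed.

(* Write [s], [u], [t] for the segments of [Z0, Z2, ..], [Z1, Z3, ..] and
   [Z2, Z4, ..]. Then [s <| t], while after homogenisation [F s] and [F u],
   [F s] and [G u] compare in the same way for all [Z], in particular as for
   [u], [t]; by maximality [F t] is comparable with [F u] or [G u], and each
   possibility composes to a forbidden comparison. *)
Lemma crossing_false B (hB : barrier B) e (e_incr : incr e)
    (e_supp : forall i, exists s, B s /\ e i \in s) (F G : seq nat -> P) H :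
  incr H -> (forall s, maximal_pair (F s) (G s)) ->
  (forall Z, incr Z -> subrange Z H ->
     let s := seg B e Z in let t := seg B e (shift Z) in
     [/\ ~ le (F s) (F t), le (F s) (G t) & le (G s) (F t)]) -> False.
Proof.
have [_ [trans _]] := le_poset.
move=> hH hmax hcross.
have incr_double : incr double by move=> i; rewrite doubleS.
pose sg Z := seg B e (Z \o double).
pose within Y Z := incr Z /\ subrange Z Y.
have within_refl Y : incr Y -> within Y Y by split=> // i; exists i.
have within_shift Y Z : within Y Z -> within Y (shift Z).
  move=> [h1 h2]; split; first exact: incr_shift.
  exact: subrange_trans (@subrange_shift _) h2.
have within_trans X Y Z : within X Y -> within Y Z -> within X Z.
  by move=> [_ h1] [h2 h3]; split=> //; exact: subrange_trans h1.
(* Shifting [Z \o double] once amounts to shifting [Z] twice. *)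
have {}hcross Z : within H Z ->
    [/\ ~ le (F (sg Z)) (F (sg (shift (shift Z)))),
        le (F (sg Z)) (G (sg (shift (shift Z)))) &
        le (G (sg Z)) (F (sg (shift (shift Z))))].
  move=> [hZ hs]; apply: hcross; first exact: incr_comp.
  exact: subrange_trans (@subrange_comp _ _) hs.
have homogenise (R : seq nat -> seq nat -> Prop) X : incr X ->
    exists Y, within X Y /\
     ((forall Z, within Y Z -> R (sg Z) (sg (shift Z))) \/
      (forall Z, within Y Z -> ~ R (sg Z) (sg (shift Z)))).
  move=> hX; have incr_odd : incr (succn \o double) by move=> i; rewrite /= ltnS doubleS.
  have [Y [h1 h2 h3]] := seg_ramsey hB e_incr e_supp R incr_double incr_odd hX.
  by exists Y; split=> //; case: h3 => h3; [left | right] => Z [? ?]; exact: h3.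
have [Y1 [HY1 c1]] := homogenise (fun s u => le (F s) (F u)) H hH.
have n1 Z : within Y1 Z -> ~ le (F (sg Z)) (F (sg (shift Z))).
  case: c1 => c1; last exact: c1.
  move=> hZ hsu; have hut := c1 _ (within_shift _ _ hZ).
  have [nst _ _] := hcross _ (within_trans _ _ _ HY1 hZ).
  by apply: nst; exact: (trans _ _ _ hsu hut).
have [Y2 [Y12 c2]] := homogenise (fun s u => le (F u) (F s)) Y1 (proj1 HY1).
have n2 Z : within Y2 Z -> ~ le (F (sg (shift Z))) (F (sg Z)).
  case: c2 => c2; last exact: c2.
  move=> hZ hus; have htu := c2 _ (within_shift _ _ hZ).
  have HZ := within_trans _ _ _ HY1 (within_trans _ _ _ Y12 hZ).
  have [_ _ GsFt] := hcross _ HZ; have [_ nGF _] := hmax (sg Z).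
  by apply: nGF; apply: (trans _ _ _ GsFt); exact: (trans _ _ _ htu hus).
have [Y [Y2Y c3]] := homogenise (fun s u => le (F s) (G u)) Y2 (proj1 Y12).
have Ys := within_refl _ (proj1 Y2Y).
have Yu := within_shift _ _ Ys; have Yt := within_shift _ _ Yu.
have n1Y Z (hZ : within Y Z) := n1 Z (within_trans _ _ _ Y12 (within_trans _ _ _ Y2Y hZ)).
have n2Y Z (hZ : within Y Z) := n2 Z (within_trans _ _ _ Y2Y hZ).
have HY := within_trans _ _ _ HY1 (within_trans _ _ _ Y12 Y2Y).
have [nFsFt FsGt _] := hcross _ HY.
have [_ _ GuFv] := hcross _ (within_shift _ _ HY).
(* In the positive case [F t] is tested against the pair at [u], using the next segment [v] when
   [F t] is below [G u]; in the negative case [F u] is tested against the pair at [t]. *)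
case: c3 => c3.
- have [_ _ /(_ (F (sg (shift (shift Y)))))] := hmax (sg (shift Y)).
  case=> -[h|h]; first exact: (n1Y _ Yu h).
  + exact: (n2Y _ Yu h).
  + by apply: nFsFt; exact: (trans _ _ _ (c3 _ Ys) h).
  + by apply: (n1Y _ Yt); exact: (trans _ _ _ h GuFv).
- have [_ _ /(_ (F (sg (shift Y))))] := hmax (sg (shift (shift Y))).
  case=> -[h|h]; first exact: (n2Y _ Yu h).
  + exact: (n1Y _ Yu h).
  + by apply: (n1Y _ Ys); exact: (trans _ _ _ FsGt h).
  + exact: (c3 _ Yu h).
Qed.

(** * The two implications *)

Variables (W : Type) (ltW : W -> W -> Prop).

Lemma alpha_bqo_UAM2 : alpha_bqo ltW (@AM2_le P le) -> alpha_bqo ltW (@UAM2_le P le).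
Proof.
move=> hQ B hB hBW f; apply: NNPP => hbad.
have [e e_incr e_supp] := barrier_enum hB.
pose F s := proj1_sig (f s).
have exA s :
    exists Ab : AM2 le * P, maximal_pair (F s) Ab.2 /\
      forall x, proj1_sig Ab.1 x <-> x = F s \/ x = Ab.2.
  have [A [hA hAF]] := proj2_sig (f s).
  have [b hb] := in_AM2_maximal_pair hA hAF.
  by exists (exist _ A hA, b).
pose Ach s := constructive_indefinite_description _ (exA s).
pose A s := (proj1_sig (Ach s)).1; pose G s := (proj1_sig (Ach s)).2.
have hmax s : maximal_pair (F s) (G s) by have [] := proj2_sig (Ach s).
have AE s x : proj1_sig (A s) x <-> x = F s \/ x = G s.
  by have [_] := proj2_sig (Ach s); apply.
have incr_id : incr id by [].
have incr_succ : incr succn by [].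
have [H [hH _ hcol]] :=
  seg_ramsey hB e_incr e_supp (fun s t => AM2_le (A s) (A t)) incr_id incr_succ incr_id.
have {hcol} hAA Z : incr Z -> subrange Z H -> AM2_le (A (seg B e Z)) (A (seg B e (shift Z))).
  case: hcol => hcol; first exact: hcol.
  have [Z' [h1 h2 h3]] := alpha_bqo_seg hB e_incr e_supp A hQ hBW hH.
  by case: (hcol Z' h1 h2).
apply: (crossing_false hB e_incr e_supp hH hmax) => Z hZ hs s t.
have nst : ~ le (F s) (F t).
  move=> hst; apply: hbad; exists s, t.
  split; first exact: seg_in.
  split; first by apply: seg_in => //; exact: incr_shift.
  by split; first exact: seg_tri.
have dom x : proj1_sig (A s) x -> le x (F t) \/ le x (G t).
  by move/(hAA Z hZ hs) => [y [/AE [->|->] hxy]]; [left | right].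
have [||//] := domination_crossing (hmax s) (hmax t) _ _ nst.
- by apply/dom/AE; left.
- by apply/dom/AE; right.
Qed.

Lemma alpha_bqo_AM2 : alpha_bqo ltW (@UAM2_le P le) -> alpha_bqo ltW (@AM2_le P le).
Proof.
move=> hQ B hB hBW f; apply: NNPP => hbad.
have [e e_incr e_supp] := barrier_enum hB.
have ex s :
    exists p : UAM2 le * UAM2 le, forall x, proj1_sig (f s) x <->
      x = proj1_sig p.1 \/ x = proj1_sig p.2.
  case: (f s) => A hA; have [_ [a [b [_ hab]]]] := hA.
  have ha : A a by apply/hab; left.
  have hb : A b by apply/hab; right.
  exists (exist _ a (ex_intro _ A (conj hA ha)), exist _ b (ex_intro _ A (conj hA hb))).
  exact: hab.
pose ch s := constructive_indefinite_description _ (ex s).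
pose f1 s := (proj1_sig (ch s)).1; pose f2 s := (proj1_sig (ch s)).2.
have fE s x : proj1_sig (f s) x <-> x = proj1_sig (f1 s) \/ x = proj1_sig (f2 s).
  exact: (proj2_sig (ch s)).
have incr_id : incr id by [].
have incr_succ : incr succn by [].
(* As in domination, the upper bound may be either element of [f t], not only [g t]. *)
pose below (g : seq nat -> UAM2 le) (s t : seq nat) :=
  exists y, proj1_sig (f t) y /\ le (proj1_sig (g s)) y.
have good_below g H : incr H -> (forall s t, UAM2_le (g s) (g t) -> below g s t) ->
    exists Z, [/\ incr Z, subrange Z H & below g (seg B e Z) (seg B e (shift Z))].
  move=> hH hg; have [Z [h1 h2 h3]] := alpha_bqo_seg hB e_incr e_supp g hQ hBW hH.
  by exists Z; split=> //; exact: hg.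
have below1 s t : UAM2_le (f1 s) (f1 t) -> below f1 s t.
  by move=> h; exists (proj1_sig (f1 t)); split=> //; apply/fE; left.
have below2 s t : UAM2_le (f2 s) (f2 t) -> below f2 s t.
  by move=> h; exists (proj1_sig (f2 t)); split=> //; apply/fE; right.
have [H [hH _ hcol]] := seg_ramsey hB e_incr e_supp (below f1) incr_id incr_succ incr_id.
have {hcol} h1 Z : incr Z -> subrange Z H -> below f1 (seg B e Z) (seg B e (shift Z)).
  case: hcol => hcol; first exact: hcol.
  by have [Z' [h1 h2 /(hcol Z' h1 h2)]] := good_below _ _ hH below1.
(* The first elements are dominated along all of [H], so one good pair for the second elements
   inside [H] settles both. *)
have [Z [hZ hs h2]] := good_below _ _ hH below2.
apply: hbad; exists (seg B e Z), (seg B e (shift Z)).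
split; first exact: seg_in.
split; first by apply: seg_in => //; exact: incr_shift.
split; first exact: seg_tri.
by move=> x /fE [->|->]; [exact: h1 | exact: h2].
Qed.

End Pairs.

Theorem theorem6p3 (P : Type) (le : P -> P -> Prop)
  (W : Type) (ltW : W -> W -> Prop) :
  is_poset le -> no_infinite_antichain le ->
  countable_well_order ltW ->
  (alpha_bqo ltW (@AM2_le P le) <-> alpha_bqo ltW (@UAM2_le P le)).
Proof.
by move=> hP _ _; split; [exact: alpha_bqo_UAM2 | exact: alpha_bqo_AM2].
Qed.
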